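(* Let $\Pi^*_\Psi$ be the optimal objective function value of $$\max_{\mathcal X}\ \mathcal G^\Psi(\mathcal X)=\sum_{k=1}^K\mathcal G^\Psi_k(x_k)\quad\text{s.t. } \sum_{k=1}^K w_kx_k\le W,\ x_k\in\mathbb Z^+,\ k=1,\dots,K,$$ and let $\Pi^g_\Psi=\mathcal G^\Psi(\mathcal X^g)$, where $\mathcal X^g$ is the feasible solution produced by the greedy algorithm described in the context. Then $$\Pi^g_\Psi\ \ge\ \Pi^*_\Psi-\bar B^{k^\circ}_{I^\circ},$$ where $k^\circ=\kappa(\rho_W)$ and $I^\circ=I_{k^\circ}(\rho_W)$.
   Context: $\mathcal X=(x_1,\dots,x_K)$; $\mathbb Z^+$ is the set of nonnegative integers; $W>0$ is a capacity and $w_k>0$ are weights; $\Psi\ge1$ is a fixed integer. Data: for each $\psi=1,\dots,\Psi$ and $k=1,\dots,K$, $\tilde Q^{(\psi)}_k=\langle(\tilde t_j^{k,(\psi)},\tilde q_j^{k,(\psi)}):j=1,\dots,\tilde n^{k,(\psi)}\rangle$ is a finite sequence with nondecreasing arrival times $\tilde t_j^{k,(\psi)}\le T_+$ and positive integer quantities; $|\tilde Q^{(\psi)}_k|=\sum_j\tilde q_j^{k,(\psi)}$. Let $B^k(t)=e^{\phi-bc_kt}(e^{bc_k\xi_k}-e^{bc_kT_+})$ with $\phi\in\mathbb R$, $b>0$, $c_k>1$, $\xi_k>T_+$ fixed. Objective: for a finite sequence $\tilde Q_k=\langle(\tilde t^k_j,\tilde q^k_j)\rangle_{j=1}^{\tilde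 n^k}$ with nondecreasing arrival times $\tilde t^k_j\le T_+$ and positive integer quantities $\tilde q^k_j$, put $|\tilde Q_k|=\sum_{j=1}^{\tilde n^k}\tilde q^k_j$, $B^k_j=B^k(\tilde t_j^k)$, and for real $x_k\ge0$ let $J^k$ be the largest $J\in\{0,\dots,\tilde n^k\}$ with $\sum_{j=1}^J\tilde q_j^k\le x_k$. Set $$g_k(x_k,\tilde Q_k)=\begin{cases}\sum_{j=1}^{J^k}\tilde q^k_jB^k_j+\big(x_k-\sum_{j=1}^{J^k}\tilde q^k_j\big)B^k_{J^k+1}&\text{if }x_k<|\tilde Q_k|,\\ \sum_{j=1}^{\tilde n^k}\tilde q^k_jB^k_j&\text{if }x_k\ge|\tilde Q_k|,\end{cases}\qquad \mathcal G^\Psi_k(x_k)=\frac1\Psi\sum_{\psi=1}^\Psi g_k(x_k,\tilde Q_k^{(\psi)}).$$ Kinks and slopes: let $s_i^{k,(\psi)}=\sum_{j=1}^i\tilde q_j^{k,(\psi)}$ for $i=1,\dots,\tilde n^{k,(\psi)}$. For each $k$, list all the $s_i^{k,(\psi)}$ (over all $\psi$ and $i$, with repetition) in nondecreasing order as $s^k_1\le\dots\le s^k_{M^k}$, $M^k=\sum_\psi\tilde n^{k,(\psi)}$. Let $\bar B^k_i$ be the left derivative of $\mathcal G^\Psi_k$ at $s^k_i$; explicitly, if $s_i^k=s^{k,(\psi)}_{\tilde i}$, then $$\bar B^k_i=\frac1\Psi\sum_{\varphi=1}^\Psi B^k\big(\tilde t^{k,(\varphi)}_{J(k,\psi,\varphi,\tilde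 i)}\big)\,\mathbf 1\big(s^{k,(\psi)}_{\tilde i}\le|\tilde Q^{(\varphi)}_k|\big),\qquad J(k,\psi,\varphi,\tilde i)=\min\{j\in\{1,\dots,\tilde n^{k,(\varphi)}\}: s_j^{k,(\varphi)}\ge s_{\tilde i}^{k,(\psi)}\}$$ (terms with zero indicator are $0$). Thus $\bar B_1^k\ge\dots\ge\bar B^k_{M^k}\ge0$. Greedy algorithm: let $\mathcal P$ be the sequence of all slopes $\bar B^k_i$ ($k=1,\dots,K$, $i=1,\dots,M^k$) ranked in descending order of the ratio $\bar B^k_i/w_k$. Let $\kappa(\rho)$ be the resource type of the $\rho$-th slope in $\mathcal P$, and $I_k(\rho)$ the number of slopes of type $k$ among the first $\rho$ slopes of $\mathcal P$. Put $x_k(\rho)=s^k_{I_k(\rho)}$ if $I_k(\rho)\neq0$, and $x_k(\rho)=0$ otherwise. Let $$\rho_W=\min\Big\{\rho\in\{1,\dots,|\mathcal P|\}:\ \sum_{k=1}^Kw_kx_k(\rho)\ge W\Big\}$$ (such a $\rho$ is assumed to exist). With $k^\circ=\kappa(\rho_W)$, let $$\tilde x_{k^\circ}=\frac1{w_{k^\circ}}\Big(W-\sum_{k\ne k^\circ}w_kx_k(\rho_W)\Big).$$ If $\sum_kw_kx_k(\rho_W)=W$, the output is $x_k^g=x_k(\rho_W)$ for all $k$; otherwise $x^g_{k^\circ}=\lfloor\tilde x_{k^\circ}\rfloor$ and $x^g_k=x_k(\rho_W)$ for $k\ne k^\circ$. Then $\mathcal X^g=(x_1^g,\dots,x_K^g)$.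 *)

(* Defs.v *)
From HB Require Import structures.
From mathcomp Require Import all_boot all_order all_algebra.
From mathcomp Require Import mathcomp_extra boolp classical_sets functions reals.
From mathcomp Require Import topology normedtype sequences exp.
From mathcomp Require Import zify ring lra.

Set Implicit Arguments.
Unset Strict Implicit.
Unset Printing Implicit Defensive.

Import Order.TTheory GRing.Theory Num.Theory.
Import numFieldNormedType.Exports.

Local Open Scope ring_scope.

Section OneResource.
Variable R : realType.

(* A finite arrival sequence is a list of (time, quantity) pairs.  All the
   indices below count from 1, so that [time Q j] is the j-th time, and
   [psum Q J] is the sum of the first J quantities. *)
Implicit Types (Q : seq (R * nat)) (B : R -> R).

Definition time Q (j : nat) : R := nth 0 (unzip1 Q) j.-1.
Definition qty Q (j : nat) : nat := nth 0%N (unzip2 Q) j.-1.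

Definition psum Q (J : nat) : nat := \sum_(1 <= j < J.+1) qty Q j.
Definition total Q : nat := psum Q (size Q).

Definition valid_arrivals (Tp : R) Q : bool :=
  [&& sorted <=%R (unzip1 Q), all (fun t => t <= Tp) (unzip1 Q)
    & all (fun q => (0 < q)%N) (unzip2 Q)].

Definition price (phi b Tp c xi t : R) : R :=
  expR (phi - b * c * t) * (expR (b * c * xi) - expR (b * c * Tp)).

Definition filled Q (x : R) : nat :=
  \max_(J < (size Q).+1 | (psum Q J)%:R <= x) J.

Definition gain B Q (x : R) : R :=
  if x < (total Q)%:R then
    \sum_(1 <= j < (filled Q x).+1) (qty Q j)%:R * B (time Q j)
    + (x - (psum Q (filled Q x))%:R) * B (time Q (filled Q x).+1)
  else \sum_(1 <= j < (size Q).+1) (qty Q j)%:R * B (time Q j).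

(* The least j in {1, ..., size Q} with s <= psum Q j, meaningful only when
   s <= total Q. *)
Definition first_reach Q (s : nat) : nat :=
  (find (fun j => (s <= psum Q j)%N) (iota 1 (size Q))).+1.

End OneResource.

Section SampleAverage.
Variables (R : realType) (Psi : nat).
Variables (B : R -> R) (Q : 'I_Psi -> seq (R * nat)).

Definition avg_gain (x : R) : R := Psi%:R^-1 * \sum_(psi < Psi) gain B (Q psi) x.

Definition kinks : seq nat :=
  sort leq [seq psum (Q psi) i | psi <- enum 'I_Psi, i <- iota 1 (size (Q psi))].

(* The explicit formula for the slope at the kink psum (Q psi) i depends on
   (psi, i) only through the value s of that kink; [avg_gain_left_derivative]
   below shows that it is the left derivative of [avg_gain] at s. *)
Definition slope_at (s : nat) : R :=
  Psi%:R^-1 * \sum_(phi < Psi)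
    (if (s <= total (Q phi))%N then B (time (Q phi) (first_reach (Q phi) s))
     else 0).

Definition kink (i : nat) : nat := nth 0%N kinks i.-1.
Definition slope (i : nat) : R := slope_at (kink i).

End SampleAverage.

Section Allocation.
Variables (R : realType) (K Psi : nat).
Variables (W : R) (w : 'I_K -> R) (B : 'I_K -> R -> R).
Variable Q : 'I_K -> 'I_Psi -> seq (R * nat).

Definition objective (x : 'I_K -> R) : R := \sum_(k < K) avg_gain (B k) (Q k) (x k).

Definition feasible (x : 'I_K -> R) : Prop :=
  (forall k, x k \is a Num.nat) /\ \sum_(k < K) w k * x k <= W.

Definition is_optimal_value (v : R) : Prop :=
  (exists2 x, feasible x & objective x = v) /\
  (forall x, feasible x -> objective x <= v).

(* The pair (k, i) stands for the i-th slope of resource type k. *)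
Definition all_slopes : seq ('I_K * nat) :=
  [seq (k, i) | k <- enum 'I_K, i <- iota 1 (size (kinks (Q k)))].

Definition ratio (p : 'I_K * nat) : R := slope (B p.1) (Q p.1) p.2 / w p.1.

(* Ties are broken arbitrarily, so the ranked sequence need not be unique. *)
Definition is_ranking (P : seq ('I_K * nat)) : Prop :=
  perm_eq P all_slopes /\ sorted (fun p q => ratio q <= ratio p) P.

Variable P : seq ('I_K * nat).

(* The type of the rho-th slope (rho counted from 1); None if there is none. *)
Definition kappa (rho : nat) : option 'I_K := onth (unzip1 P) rho.-1.

Definition num_slopes (k : 'I_K) (rho : nat) : nat :=
  count (fun p => p.1 == k) (take rho P).

Definition level (rho : nat) (k : 'I_K) : R :=
  if num_slopes k rho == 0%N then 0 else (kink (Q k) (num_slopes k rho))%:R.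

Definition reaches_capacity (rho : nat) : Prop :=
  (1 <= rho <= size P)%N /\ W <= \sum_(k < K) w k * level rho k.

Definition is_stopping_rank (rho : nat) : Prop :=
  reaches_capacity rho /\ (forall r, reaches_capacity r -> (rho <= r)%N).

Definition fractional_level (rho : nat) (k0 : 'I_K) : R :=
  (w k0)^-1 * (W - \sum_(k < K | k != k0) w k * level rho k).

Definition greedy_output (rho : nat) (k0 : 'I_K) : 'I_K -> R := fun k =>
  if \sum_(l < K) w l * level rho l == W then level rho k
  else if k == k0 then (Num.floor (fractional_level rho k0))%:~R
  else level rho k.

End Allocation.

Section LeftDerivative.
Variable R : realType.
Implicit Types (Q : seq (R * nat)) (B : R -> R).
Local Open Scope classical_set_scope.

Lemma psumS Q J : psum Q J.+1 = (psum Q J + qty Q J.+1)%N.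
Proof. by rewrite /psum big_nat_recr. Qed.

Lemma leq_psum Q i j : (i <= j)%N -> (psum Q i <= psum Q j)%N.
Proof.
move=> /subnK <-; elim: (j - i)%N => [//|d IH].
by rewrite addSn psumS (leq_trans IH) // leq_addr.
Qed.

Lemma ltn_psum Q i j : all (fun q => (0 < q)%N) (unzip2 Q) ->
  (i < j)%N -> (j <= size Q)%N -> (psum Q i < psum Q j)%N.
Proof.
move=> q0 ij jQ; apply: (@leq_trans (psum Q i.+1)); last exact: leq_psum.
rewrite psumS -addn1 leq_add2l /qty /=.
by apply: (allP q0); apply: mem_nth; rewrite size_map; lia.
Qed.

Lemma filled_eq Q (x : R) (J : nat) : all (fun q => (0 < q)%N) (unzip2 Q) ->
  (J < size Q)%N -> (psum Q J)%:R <= x -> x < (psum Q J.+1)%:R -> filled Q x = J.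
Proof.
move=> q0 JQ lx xl; apply/eqP; rewrite eqn_leq; apply/andP; split.
  apply/bigmax_leqP => i ix; rewrite leqNgt; apply/negP => Ji.
  have := le_lt_trans ix xl; rewrite ltr_nat ltnNge => /negP; apply.
  exact: leq_psum.
have JQ' : (J < (size Q).+1)%N by lia.
exact: (@leq_bigmax_cond _ _ (fun i : 'I_(size Q).+1 => i : nat)
  (Ordinal JQ') lx).
Qed.

Lemma gain_piece B Q (x : R) (j : nat) :
  all (fun q => (0 < q)%N) (unzip2 Q) -> (j < size Q)%N ->
  (psum Q j)%:R <= x -> x <= (psum Q j.+1)%:R ->
  gain B Q x = \sum_(1 <= i < j.+1) (qty Q i)%:R * B (time Q i)
    + (x - (psum Q j)%:R) * B (time Q j.+1).
Proof.
move=> q0 jQ lx; rewrite le_eqVlt => /orP[/eqP xE|xl]; last first.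
  rewrite /gain (filled_eq q0 jQ lx xl) ifT //.
  by apply: (lt_le_trans xl); rewrite ler_nat; exact: leq_psum.
have sumE : \sum_(1 <= i < j.+2) (qty Q i)%:R * B (time Q i) =
   \sum_(1 <= i < j.+1) (qty Q i)%:R * B (time Q i)
    + (x - (psum Q j)%:R) * B (time Q j.+1).
  by rewrite big_nat_recr //= xE psumS natrD addrAC subrr add0r.
rewrite -sumE /gain; have [jQ1|jQ1] := ltnP j.+1 (size Q).
  have xt : x < (psum Q j.+2)%:R by rewrite xE ltr_nat ltn_psum.
  rewrite (filled_eq q0 jQ1 _ xt) ?xE ?subrr ?mul0r ?addr0 ?if_same //.
  rewrite ifT // ltr_nat /total; exact: ltn_psum.
have -> : j.+1 = size Q by lia.
rewrite ifF //; apply/negbTE; rewrite -leNgt xE ler_nat /total.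
by have -> : j.+1 = size Q by lia.
Qed.

Lemma first_reachP Q (s : nat) : (0 < s)%N -> (s <= total Q)%N ->
  exists j, [/\ first_reach Q s = j.+1, (j < size Q)%N,
    (psum Q j < s)%N & (s <= psum Q j.+1)%N].
Proof.
move=> s0 sQ; rewrite /first_reach; set a := (fun j => (s <= psum Q j)%N).
have Q0 : (0 < size Q)%N.
  case: (posnP (size Q)) sQ => [Q0|//]; rewrite /total Q0 /psum big_geq //; lia.
have ha : has a (iota 1 (size Q)).
  by apply/hasP; exists (size Q) => //; rewrite mem_iota; lia.
have := ha; rewrite has_find size_iota => fQ.
exists (find a (iota 1 (size Q))); split => //.
  case E: (find a (iota 1 (size Q))) => [|f]; first by rewrite /psum big_geq.
  have /(before_find 0%N) : (f < find a (iota 1 (size Q)))%N by rewrite E.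
  by rewrite nth_iota ?add1n; [move/negbT; rewrite -ltnNge | lia].
by have := nth_find 0%N ha; rewrite nth_iota // add1n.
Qed.

Lemma gain_left B Q (s : nat) (h : R) :
  all (fun q => (0 < q)%N) (unzip2 Q) -> (0 < s)%N -> -1 <= h -> h <= 0 ->
  gain B Q (s%:R + h) - gain B Q s%:R =
  h * (if (s <= total Q)%N then B (time Q (first_reach Q s)) else 0).
Proof.
move=> q0 s0 h1 h0; case: leqP => sQ.
  have [j [-> jQ sj js]] := first_reachP s0 sQ.
  have sj' : (psum Q j)%:R + 1 <= s%:R :> R by rewrite natr1 ler_nat.
  have js' : s%:R <= (psum Q j.+1)%:R :> R by rewrite ler_nat.
  by rewrite !(gain_piece B q0 jQ) //; [ring | lra..].
have sQ' : (total Q)%:R + 1 <= s%:R :> R by rewrite natr1 ler_nat.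
rewrite /gain !ifF ?subrr ?mulr0 //; apply/negbTE; rewrite -leNgt; lra.
Qed.

Lemma avg_gain_left_derivative (Psi : nat) B (Q : 'I_Psi -> seq (R * nat))
    (s : nat) :
  (forall psi, all (fun q => (0 < q)%N) (unzip2 (Q psi))) -> (0 < s)%N ->
  h^-1 * (avg_gain B Q (s%:R + h) - avg_gain B Q s%:R) @[h --> (0 : R)^'-]
    --> slope_at B Q s.
Proof.
move=> q0 s0; apply: cvg_near_cst; near=> h.
have h0 : h < 0 by near: h; exact: nbhs_left_lt.
have h1 : -1 <= h.
  by apply: ltW; near: h; apply: nbhs_left_gt; rewrite ltrN10.
rewrite /avg_gain /slope_at -mulrBr -sumrB mulrCA; congr (_ * _).
rewrite mulr_sumr; apply: eq_bigr => psi _.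
by rewrite gain_left ?(ltW h0) // mulKf // lt_eqF.
Unshelve. all: by end_near. Qed.

End LeftDerivative.

(* Main.v *)
(* The increment of the averaged gain of type k from s - 1 to s is the slope at
   s, which is nonnegative, nonincreasing in s and constant between kinks.  Let
   lambda be the ratio of the slope at which the greedy algorithm stops.  Every
   unit below the greedy level x_k has slope at least lambda * w_k, and every
   unit above it has slope at most lambda * w_k (for k°, rounding down stays
   inside a segment of slope lambda * w_k°).  So x^g maximises the Lagrangian
   sum_k (G_k(x_k) - lambda * w_k * x_k), and the loss is at most lambda times
   the unused capacity, which is less than w_k° because of the rounding. *)
Require Import Defs.
From mathcomp Require Import all_boot all_order all_algebra.
From mathcomp Require Import reals exp.
From mathcomp Require Import zify ring lra.

Set Implicit Arguments.
Unset Strict Implicit.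
Unset Printing Implicit Defensive.

Import Order.TTheory GRing.Theory Num.Theory.

Local Open Scope ring_scope.

(** * Prices, and splittings of the index range [1, ..., m] *)

Lemma price_ge0 (R : realType) (phi b Tp c xi t : R) :
  0 < b -> 0 < c -> Tp < xi -> 0 <= price phi b Tp c xi t.
Proof.
move=> b0 c0 Txi; rewrite mulr_ge0 ?expR_ge0 // subr_ge0 ler_expR.
by rewrite ler_pM2l ?mulr_gt0 // ltW.
Qed.

Lemma price_nonincreasing (R : realType) (phi b Tp c xi t u : R) :
  0 < b -> 0 < c -> Tp < xi -> t <= u ->
  price phi b Tp c xi u <= price phi b Tp c xi t.
Proof.
move=> b0 c0 Txi tu; apply: ler_wpM2r.
  by rewrite subr_ge0 ler_expR ler_pM2l ?mulr_gt0 // ltW.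
by rewrite ler_expR lerD2l lerN2 ler_pM2l ?mulr_gt0.
Qed.

(** Pigeonhole: distinct positive integers all below [size l1] would number at most [(size l1).-1].
    This handles ties: the first n slopes of a type met in the ranking need not be those of index 1
    to n, but one of them has index at least n. *)
Lemma perm_iota_cat_exists_ge (l1 l2 : seq nat) (m : nat) :
  perm_eq (l1 ++ l2) (iota 1 m) -> (0 < size l1)%N ->
  exists2 i, i \in l1 & (size l1 <= i)%N.
Proof.
move=> pl l0; apply/hasP/negPn/negP => /hasPn small.
have ul : uniq l1.
  by have := iota_uniq 1 m; rewrite -(perm_uniq pl) cat_uniq => /and3P[].
have : {subset l1 <= iota 1 (size l1).-1}.
  move=> i il; have := small i il.
  have : i \in iota 1 m by rewrite -(perm_mem pl) mem_cat il.
  by rewrite !mem_iota; lia.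
by move/(uniq_leq_size ul); rewrite size_iota leqNgt prednK // leqnn.
Qed.

(** Dual pigeonhole: if all of [l2] exceeded [(size l1).+1], its [m - size l1] entries would have to
    fit in one place fewer. *)
Lemma perm_iota_cat_exists_le (l1 l2 : seq nat) (m : nat) :
  perm_eq (l1 ++ l2) (iota 1 m) -> (size l1 < m)%N ->
  exists2 i, i \in l2 & (i <= (size l1).+1)%N.
Proof.
move=> pl lm; apply/hasP/negPn/negP => /hasPn large.
have ul : uniq l2.
  by have := iota_uniq 1 m; rewrite -(perm_uniq pl) cat_uniq => /and3P[].
have sz : (size l1 + size l2 = m)%N.
  by rewrite -size_cat (perm_size pl) size_iota.
have : {subset l2 <= iota (size l1).+2 (m - (size l1).+1)}.
  move=> i il; have := large i il.
  have : i \in iota 1 m by rewrite -(perm_mem pl) mem_cat il orbT.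
  by rewrite !mem_iota; lia.
move/(uniq_leq_size ul); rewrite size_iota -sz subnS addKn leqNgt prednK ?leqnn //.
by move: lm; rewrite -sz -[X in (X < _)%N]addn0 ltn_add2l.
Qed.

(** * Slopes and concavity of the averaged gain of one type *)

Section OneResource.
Variables (R : realType) (Psi : nat) (Tp : R) (B : R -> R).
Variable Q : 'I_Psi -> seq (R * nat).
Hypothesis B_ge0 : forall t, 0 <= B t.
Hypothesis B_nonincreasing : forall t u, t <= u -> B u <= B t.
Hypothesis Q_valid : forall psi, valid_arrivals Tp (Q psi).

Let Q_qty_gt0 psi : all (fun q => (0 < q)%N) (unzip2 (Q psi)).
Proof. by case/and3P: (Q_valid psi). Qed.

Lemma slope_at_ge0 (s : nat) : 0 <= slope_at B Q s.
Proof.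
rewrite mulr_ge0 ?invr_ge0 ?ler0n // sumr_ge0 // => psi _.
by case: ifP.
Qed.

(** In each sample a later unit belongs to an arrival that is no earlier, hence no dearer; beyond
    the sample's total the term drops to 0, which is at most any price. *)
Lemma slope_at_nonincreasing (s u : nat) : (0 < s)%N -> (s <= u)%N ->
  slope_at B Q u <= slope_at B Q s.
Proof.
move=> s0 su; apply: ler_wpM2l; first by rewrite invr_ge0.
apply: ler_sum => psi _.
case: (leqP u) => [ut|_]; last by case: ifP.
rewrite (leq_trans su ut).
have [i [-> iQ is_ si]] := first_reachP s0 (leq_trans su ut).
have [j [-> jQ ju uj]] := first_reachP (leq_trans s0 su) ut.
apply: B_nonincreasing; rewrite /time /=.
have [st _ _] := and3P (Q_valid psi).
apply: (sorted_leq_nth le_trans le_refl 0 st);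
  rewrite ?inE ?size_map //.
rewrite leqNgt; apply/negP => ji.
by have := leq_psum (Q psi) ji; lia.
Qed.

Lemma mem_kinks psi i : (0 < i <= size (Q psi))%N ->
  psum (Q psi) i \in kinks Q.
Proof.
move=> iQ; rewrite mem_sort; apply/allpairsPdep; exists psi, i.
by rewrite mem_enum mem_iota; split=> //; lia.
Qed.

Lemma kinks_gt0 s : s \in kinks Q -> (0 < s)%N.
Proof.
rewrite mem_sort => /allpairsPdep[psi [i [_]]]; rewrite mem_iota => iQ ->.
have := @ltn_psum R (Q psi) 0 i (Q_qty_gt0 psi); lia.
Qed.

Lemma total_kink psi s : (0 < s)%N -> (s <= Defs.total (Q psi))%N ->
  Defs.total (Q psi) \in kinks Q.
Proof.
move=> s0 st; have [j [_ jQ _ _]] := first_reachP s0 st.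
by apply: mem_kinks; lia.
Qed.

(** All partial sums of each sample, its total included, are kinks. With none in [s, u), a sample
    that contains unit s also contains unit u, and in the same arrival. *)
Lemma slope_at_kinkfree (s u : nat) : (0 < s)%N -> (s <= u)%N ->
  (forall t, t \in kinks Q -> (s <= t)%N -> (u <= t)%N) ->
  slope_at B Q s <= slope_at B Q u.
Proof.
move=> s0 su free; apply: ler_wpM2l; first by rewrite invr_ge0.
apply: ler_sum => psi _.
case: (leqP s) => [st|_]; last by case: ifP.
have ut := free _ (total_kink s0 st) st; rewrite ut.
have [i [-> iQ is_ si]] := first_reachP s0 st.
have [j [-> jQ ju uj]] := first_reachP (leq_trans s0 su) ut.
suff -> : i = j by [].
have ui : (u <= psum (Q psi) i.+1)%N by apply: free => //; apply: mem_kinks.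
case: (ltngtP i j) => // ij.
  by have := leq_trans ui (leq_psum (Q psi) ij); rewrite leqNgt ju.
have := leq_trans uj (leq_psum (Q psi) ij).
by rewrite leqNgt (leq_trans is_ su).
Qed.

Lemma slope_at_beyond (s : nat) : (0 < s)%N ->
  (forall t, t \in kinks Q -> (t < s)%N) -> slope_at B Q s = 0.
Proof.
move=> s0 ks; rewrite /slope_at big1 ?mulr0 // => psi _.
case: leqP => // st; have := ks _ (total_kink s0 st); lia.
Qed.

Lemma leq_kink (i j : nat) : (0 < i)%N -> (i <= j)%N ->
  (j <= size (kinks Q))%N -> (kink Q i <= kink Q j)%N.
Proof.
move=> i0 ij jM; apply: (sorted_leq_nth leq_trans leqnn) => //.
- exact/sort_sorted/leq_total.
- by rewrite inE; lia.
- by rewrite inE; lia.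
- lia.
Qed.

Lemma kink_gt0 i : (0 < i <= size (kinks Q))%N -> (0 < kink Q i)%N.
Proof. by case: i => // i iM; apply/kinks_gt0/mem_nth. Qed.

Lemma kinksP t : t \in kinks Q ->
  exists2 i, (0 < i <= size (kinks Q))%N & t = kink Q i.
Proof.
by move=> /(nthP 0%N)[i iM <-]; exists i.+1.
Qed.

Lemma slope_nonincreasing (i j : nat) : (0 < i)%N -> (i <= j)%N ->
  (j <= size (kinks Q))%N -> slope B Q j <= slope B Q i.
Proof.
move=> i0 ij jM; apply: slope_at_nonincreasing; last exact: leq_kink.
by apply: kink_gt0; lia.
Qed.

(** The case 0 is separate because [kink Q 0] is the first kink, as [0.-1 = 0]. *)
Definition nat_level (m : nat) : nat := if m == 0%N then 0%N else kink Q m.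

(** Only slopes at kinks are ranked. A unit in the gap before the next kink shares that kink's
    slope; units from that kink on are covered by monotonicity. *)
Lemma slope_at_above (m s : nat) : (m < size (kinks Q))%N ->
  (nat_level m < s)%N -> slope_at B Q s <= slope B Q m.+1.
Proof.
move=> mM ms; have [ks|ks] := leqP (kink Q m.+1) s.
  by apply: slope_at_nonincreasing => //; apply: kink_gt0; lia.
apply: slope_at_kinkfree; [lia..|] => t /kinksP[i iM ->] si.
apply: leq_kink => //; last lia.
rewrite ltnNge; apply/negP => im; move: ms; rewrite /nat_level ifF; last lia.
have : (kink Q i <= kink Q m)%N by apply: leq_kink; lia.
lia.
Qed.

Lemma slope_at_above_last (s : nat) :
  (nat_level (size (kinks Q)) < s)%N -> slope_at B Q s = 0.
Proof.
move=> ms; apply: slope_at_beyond => [|t /kinksP[i iM ->]]; first lia.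
apply: leq_ltn_trans ms; rewrite /nat_level ifF; last lia.
by apply: leq_kink; lia.
Qed.

Lemma avg_gainS (n : nat) :
  avg_gain B Q n.+1%:R = avg_gain B Q n%:R + slope_at B Q n.+1.
Proof.
suff : avg_gain B Q n%:R - avg_gain B Q n.+1%:R = - slope_at B Q n.+1 by lra.
rewrite /avg_gain /slope_at -mulrBr -sumrB -mulrN; congr (_ * _).
rewrite -sumrN; apply: eq_bigr => psi _.
(* The left-increment formula with h = -1 spans exactly the unit from n to n + 1. *)
have -> : n%:R = n.+1%:R + -1 :> R by rewrite -natr1 addrK.
by rewrite gain_left ?mulN1r ?lexx ?lerN10.
Qed.

Lemma avg_gain_rise (l : R) (m d : nat) :
  (forall s, (m < s)%N -> slope_at B Q s <= l) ->
  avg_gain B Q (m + d)%:R <= avg_gain B Q m%:R + l * d%:R.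
Proof.
move=> above; elim: d => [|d IH]; first by rewrite addn0 mulr0 addr0.
rewrite addnS avg_gainS -natr1.
by have := above (m + d).+1; rewrite ltnS leq_addr => /(_ isT); lra.
Qed.

Lemma avg_gain_drop (l : R) (m d : nat) :
  (forall s, (0 < s <= m + d)%N -> l <= slope_at B Q s) ->
  avg_gain B Q m%:R <= avg_gain B Q (m + d)%:R - l * d%:R.
Proof.
elim: d => [|d IH] below; first by rewrite addn0 mulr0 subr0.
have /IH IHd : forall s, (0 < s <= m + d)%N -> l <= slope_at B Q s.
  by move=> s sd; apply: below; lia.
rewrite addnS avg_gainS -natr1.
by have := below (m + d).+1; rewrite addnS leqnn => /(_ isT); lra.
Qed.

(** Concavity on the integers: moving right from [a] gains at most [l] per unit, moving left loses
    at least [l] per unit. *)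
Lemma avg_gain_supergradient (l : R) (a n : nat) :
  (forall s, (0 < s <= a)%N -> l <= slope_at B Q s) ->
  (forall s, (a < s)%N -> slope_at B Q s <= l) ->
  avg_gain B Q n%:R <= avg_gain B Q a%:R + l * (n%:R - a%:R).
Proof.
move=> below above; have [/subnKC an|/ltnW /subnKC na] := leqP a n.
  by rewrite -an [X in l * (X - _)]natrD addrAC subrr add0r; apply: avg_gain_rise.
rewrite -na [X in l * (_ - X)]natrD opprD addrA subrr add0r mulrN.
by apply: avg_gain_drop; rewrite na.
Qed.

End OneResource.

(** * Slopes taken and slopes left at a given rank *)

Section Ranking.
Variables (R : realType) (K Psi : nat) (Tp : R).
Variables (w : 'I_K -> R) (B : 'I_K -> R -> R).
Variable Q : 'I_K -> 'I_Psi -> seq (R * nat).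
Hypothesis w_gt0 : forall k, 0 < w k.
Hypothesis B_ge0 : forall k t, 0 <= B k t.
Hypothesis B_nonincreasing : forall k t u, t <= u -> B k u <= B k t.
Hypothesis Q_valid : forall k psi, valid_arrivals Tp (Q k psi).
Variable P : seq ('I_K * nat).
Hypothesis P_ranking : is_ranking w B Q P.

Definition indices (k : 'I_K) (s : seq ('I_K * nat)) : seq nat :=
  [seq p.2 | p <- s & p.1 == k].

Lemma mem_indices k s i : (i \in indices k s) = ((k, i) \in s).
Proof.
apply/mapP/idP => [[[l j]]|ks]; last by exists (k, i); rewrite // mem_filter eqxx.
by rewrite mem_filter => /andP[/= /eqP -> ks] ->.
Qed.

Lemma perm_indices k : perm_eq (indices k P) (iota 1 (size (kinks (Q k)))).
Proof.
have [pP _] := P_ranking.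
apply: uniq_perm; [|exact: iota_uniq|].
- rewrite map_inj_in_uniq => [|[l i] [m j]]; last first.
    by rewrite !mem_filter /= => /andP[/eqP-> _] /andP[/eqP-> _] ->.
  rewrite filter_uniq // (perm_uniq pP); apply: allpairs_uniq_dep.
  + exact: enum_uniq.
  + by move=> *; exact: iota_uniq.
  + by move=> [l i] [m j] _ _ /= [-> ->].
- move=> i; rewrite mem_indices (perm_mem pP); apply/allpairsPdep/idP.
    by move=> [l [j [_ jM [-> ->]]]].
  by move=> iM; exists k, i; rewrite mem_enum.
Qed.

Lemma perm_indices_split k r :
  perm_eq (indices k (take r P) ++ indices k (drop r P))
    (iota 1 (size (kinks (Q k)))).
Proof. by rewrite -map_cat -filter_cat cat_take_drop perm_indices. Qed.

Lemma size_indices_take k r : size (indices k (take r P)) = num_slopes P k r.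
Proof. by rewrite size_map size_filter. Qed.

Lemma num_slopes_le k r : (num_slopes P k r <= size (kinks (Q k)))%N.
Proof.
have := perm_size (perm_indices_split k r).
by rewrite size_cat size_iota size_indices_take => <-; exact: leq_addr.
Qed.

Lemma ratio_nonincreasing p0 i j : (i <= j)%N -> (j < size P)%N ->
  Defs.ratio w B Q (nth p0 P j) <= Defs.ratio w B Q (nth p0 P i).
Proof.
have [_ sP] := P_ranking => ij jP.
apply: (sorted_leq_nth (leT := fun p q => Defs.ratio w B Q q <= Defs.ratio w B Q p)) => //.
- by move=> p q r /= pq qr; exact: le_trans qr pq.
- by rewrite inE; lia.
Qed.

(** Some taken index of type k is at least [num_slopes P k r], so its slope, which is at least
    [l * w k], bounds the wanted slope from below. *)
Lemma slope_of_taken k r (l : R) :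
  (forall p, p \in take r P -> l <= Defs.ratio w B Q p) ->
  (0 < num_slopes P k r)%N -> l * w k <= slope (B k) (Q k) (num_slopes P k r).
Proof.
move=> lP n0; have := perm_iota_cat_exists_ge (perm_indices_split k r).
rewrite size_indices_take => /(_ n0)[i ik ni].
have iM : i \in iota 1 (size (kinks (Q k))).
  by rewrite -(perm_mem (perm_indices_split k r)) mem_cat ik.
move: ik; rewrite mem_indices => /lP; rewrite /ratio ler_pdivlMr //= => /le_trans.
apply; apply: (slope_nonincreasing (B_ge0 k) (B_nonincreasing k) (Q_valid k)) => //.
by move: iM; rewrite mem_iota; lia.
Qed.

Lemma slope_of_left k r (l : R) :
  (forall p, p \in drop r P -> Defs.ratio w B Q p <= l) ->
  (num_slopes P k r < size (kinks (Q k)))%N ->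
  slope (B k) (Q k) (num_slopes P k r).+1 <= l * w k.
Proof.
move=> lP nM; have := perm_iota_cat_exists_le (perm_indices_split k r).
rewrite size_indices_take => /(_ nM)[i ik ni].
have iM : i \in iota 1 (size (kinks (Q k))).
  by rewrite -(perm_mem (perm_indices_split k r)) mem_cat ik orbT.
move: ik; rewrite mem_indices => /lP; rewrite /ratio ler_pdivrMr //=; apply: le_trans.
apply: (slope_nonincreasing (B_ge0 k) (B_nonincreasing k) (Q_valid k)) => //.
by move: iM; rewrite mem_iota; lia.
Qed.

Definition unit_level r k : nat := nat_level (Q k) (num_slopes P k r).

Lemma levelE r k : level Q P r k = (unit_level r k)%:R.
Proof. by rewrite /level /unit_level /nat_level; case: ifP. Qed.

Lemma slope_at_le_level k r (l : R) s :
  (forall p, p \in take r P -> l <= Defs.ratio w B Q p) ->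
  (0 < s <= unit_level r k)%N -> l * w k <= slope_at (B k) (Q k) s.
Proof.
rewrite /unit_level /nat_level => lP; case: (posnP (num_slopes P k r)) => [_|n0]; first lia.
move=> /andP[s0 sk]; apply: (le_trans (slope_of_taken lP n0)).
exact: (slope_at_nonincreasing (B_ge0 k) (B_nonincreasing k) (Q_valid k)).
Qed.

(** If all slopes of type k are taken, further units have slope 0; this case is where [0 <= l]
    enters. *)
Lemma slope_at_gt_level k r (l : R) s : 0 <= l ->
  (forall p, p \in drop r P -> Defs.ratio w B Q p <= l) ->
  (unit_level r k < s)%N -> slope_at (B k) (Q k) s <= l * w k.
Proof.
rewrite /unit_level => l0 lP ks.
have [nM|Mn] := ltnP (num_slopes P k r) (size (kinks (Q k))).
  apply: le_trans (slope_of_left lP nM).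
  exact: (slope_at_above (B_ge0 k) (B_nonincreasing k) (Q_valid k)).
have nM : num_slopes P k r = size (kinks (Q k)).
  by apply/eqP; rewrite eqn_leq num_slopes_le.
rewrite slope_at_above_last -?nM //.
by rewrite mulr_ge0 // ltW.
Qed.

(** * The stopping rank and the greedy output *)

Variables (W : R) (rho : nat) (k0 : 'I_K).
Hypothesis W_gt0 : 0 < W.
Hypothesis rho_stops : is_stopping_rank W w Q P rho.
Hypothesis rho_type : kappa P rho = Some k0.

Lemma stopping_rank_bounds : (0 < rho <= size P)%N.
Proof. by case: rho_stops => -[]. Qed.

Lemma take_stopping_rank :
  exists i, take rho P = rcons (take rho.-1 P) (k0, i).
Proof.
have /andP[rho0 rhoP] := stopping_rank_bounds.
have rP : (rho.-1 < size P)%N by rewrite prednK.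
exists (nth (k0, 0%N) P rho.-1).2; rewrite -[in LHS](prednK rho0).
rewrite (take_nth (k0, 0%N) rP); congr rcons.
have : (nth (k0, 0%N) P rho.-1).1 = k0.
  have := rho_type; rewrite /kappa onthE -map_comp (nth_map (k0, 0%N)) //.
  by case.
by case: (nth _ _ _) => ? ? /= ->.
Qed.

Lemma num_slopes_stopping k :
  num_slopes P k rho = (num_slopes P k rho.-1 + (k == k0))%N.
Proof.
have [i Pi] := take_stopping_rank.
by rewrite /num_slopes Pi -cats1 count_cat /= addn0 eq_sym.
Qed.

Lemma unit_level_stopping_neq k : k != k0 ->
  unit_level rho.-1 k = unit_level rho k.
Proof. by rewrite /unit_level num_slopes_stopping => /negbTE ->; rewrite addn0. Qed.

Lemma unit_level_pred_le k : (unit_level rho.-1 k <= unit_level rho k)%N.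
Proof.
have [->|kk0] := eqVneq k k0; last by rewrite unit_level_stopping_neq.
have := num_slopes_le k0 rho.
rewrite /unit_level num_slopes_stopping eqxx addn1 /nat_level /= => nM.
by case: (posnP (num_slopes P k0 rho.-1)) => // n0; apply: leq_kink.
Qed.

Lemma total_pred_lt_capacity : \sum_(k < K) w k * (unit_level rho.-1 k)%:R < W.
Proof.
rewrite ltNge; apply/negP => Wr.
have /andP[rho0 rhoP] := stopping_rank_bounds.
have [_ rho_min] := rho_stops.
(* Minimality of [rho] says nothing about rank 0, which [reaches_capacity] excludes; there all
   levels are 0 and [0 < W] suffices. *)
have [r0|r0] := posnP rho.-1.
  move: Wr; rewrite r0 big1 ?leNgt ?W_gt0 // => k _.
  by rewrite /unit_level /num_slopes take0 mulr0.
have /rho_min : reaches_capacity W w Q P rho.-1.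
  split; first by rewrite r0 (leq_trans (leq_pred _)).
  by under eq_bigr do rewrite levelE.
by rewrite leqNgt prednK // leqnn.
Qed.

Lemma capacity_le_total : W <= \sum_(k < K) w k * (unit_level rho k)%:R.
Proof.
by have [[_ +] _] := rho_stops; under eq_bigr do rewrite levelE.
Qed.

(** Between ranks [rho.-1] and [rho] only the level of [k0] changes, while the used capacity passes
    from below W to at least W; the fractional level is where it equals W. *)
Lemma fractional_level_bounds :
  (unit_level rho.-1 k0)%:R <= fractional_level W w Q P rho k0
    <= (unit_level rho k0)%:R.
Proof.
rewrite /fractional_level mulrC ler_pdivlMr // ler_pdivrMr //.
under eq_bigr do rewrite levelE.
have lo := total_pred_lt_capacity; have hi := capacity_le_total.
rewrite (bigD1 k0) //= in hi; rewrite (bigD1 k0) //= in lo.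
have rest : \sum_(k < K | k != k0) w k * (unit_level rho.-1 k)%:R =
    \sum_(k < K | k != k0) w k * (unit_level rho k)%:R.
  by apply: eq_bigr => k kk0; rewrite unit_level_stopping_neq.
rewrite rest in lo; apply/andP; split; lra.
Qed.

(** The lower bound on [n] survives rounding since the previous level is an integer below the
    fractional level. Rounding loses at most one unit of [k0], hence at most [w k0] of capacity. *)
Lemma greedy_output_units : exists n : 'I_K -> nat,
  [/\ forall k, greedy_output W w Q P rho k0 k = (n k)%:R,
      forall k, (unit_level rho.-1 k <= n k <= unit_level rho k)%N
    & W - \sum_(k < K) w k * (n k)%:R <= w k0].
Proof.
rewrite /greedy_output.
have [full|_] := eqVneq (\sum_(k < K) w k * level Q P rho k) W.
  exists (unit_level rho); split=> [k|k|]; first by rewrite levelE.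
    by rewrite unit_level_pred_le leqnn.
  rewrite -full; under eq_bigr do rewrite levelE.
  by rewrite subrr ltW.
have /andP[fl lf] := fractional_level_bounds.
set f := fractional_level _ _ _ _ _ _ in fl lf *.
have f0 : 0 <= Num.floor f by rewrite floor_ge0 (le_trans _ fl).
have fE : (Num.floor f)%:~R = `|Num.floor f|%N%:R :> R.
  by rewrite -[in LHS](gez0_abs f0).
exists (fun k => if k == k0 then `|Num.floor f|%N else unit_level rho k).
split=> [k|k|].
- by case: ifP => _; rewrite ?levelE.
- case: eqP => [->|/eqP kk0]; last by rewrite unit_level_pred_le leqnn.
  rewrite -!(ler_nat R) -fE (le_trans (Num.Theory.floor_le f) lf) andbT.
  by rewrite [X in X <= _]pmulrn ler_int floor_ge_int.
rewrite (bigD1 k0) //= eqxx -fE.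
have -> : \sum_(k < K | k != k0)
    w k * (if k == k0 then `|Num.floor f|%N else unit_level rho k)%:R =
    \sum_(k < K | k != k0) w k * level Q P rho k.
  by apply: eq_bigr => k /negbTE ->; rewrite levelE.
have fW : w k0 * f = W - \sum_(k < K | k != k0) w k * level Q P rho k.
  by rewrite mulVKf // gt_eqF.
have := ltW (floorD1_gt f).
rewrite intrD mulr1z -(ler_pM2l (w_gt0 k0)) mulrDr mulr1 fW; lra.
Qed.

End Ranking.

(** * The Lagrangian bound on the greedy loss *)

Theorem theorem3 (R : realType) (K Psi : nat)
    (W : R) (w : 'I_K -> R)
    (phi b Tp : R) (c xi : 'I_K -> R)
    (Q : 'I_K -> 'I_Psi -> seq (R * nat)) :
  let B := fun k : 'I_K => price phi b Tp (c k) (xi k) in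
  (1 <= Psi)%N ->
  0 < W ->
  (forall k, 0 < w k) ->
  0 < b ->
  (forall k, 1 < c k) ->
  (forall k, Tp < xi k) ->
  (forall k psi, valid_arrivals Tp (Q k psi)) ->
  forall (PiStar : R), is_optimal_value W w B Q PiStar ->
  forall (P : seq ('I_K * nat)), is_ranking w B Q P ->
  forall (rhoW : nat), is_stopping_rank W w Q P rhoW ->
  forall (k0 : 'I_K), kappa P rhoW = Some k0 ->
  PiStar - slope (B k0) (Q k0) (num_slopes P k0 rhoW)
    <= objective B Q (greedy_output W w Q P rhoW k0).
Proof.
move=> B Psi1 W0 w0 b0 c1 Txi Qv PiStar [[x [xnat xW] <-] _] P Prk rho rs k0 rt.
have c0 k : 0 < c k := lt_trans ltr01 (c1 k).
have B0 k t : 0 <= B k t by exact: price_ge0.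
have Bd k t u : t <= u -> B k u <= B k t by exact: price_nonincreasing.
have /andP[rho0 rhoP] := stopping_rank_bounds rs.
have rP : (rho.-1 < size P)%N by rewrite prednK.
pose p0 := (k0, 0%N); pose l := Defs.ratio w B Q (nth p0 P rho.-1).
have l0 : 0 <= l by rewrite divr_ge0 ?slope_at_ge0 // ltW.
have taken p : p \in take rho P -> l <= Defs.ratio w B Q p.
  move=> /(nthP p0)[i]; rewrite size_takel // => ir <-; rewrite nth_take //.
  by apply: ratio_nonincreasing => //; rewrite -ltnS prednK.
(* The stopping slope lies in both [take rho P] and [drop rho.-1 P], so [l] is a valid multiplier
   for any [n] between the levels at ranks [rho.-1] and [rho]. *)
have left p : p \in drop rho.-1 P -> Defs.ratio w B Q p <= l.
  move=> /(nthP p0)[i]; rewrite size_drop ltn_subRL => ir <-; rewrite nth_drop.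
  by apply: ratio_nonincreasing => //; rewrite leq_addr.
have [n [gE nb nW]] := greedy_output_units w0 Prk W0 rs rt.
have : objective B Q x <=
    \sum_(k < K) (avg_gain (B k) (Q k) (n k)%:R + l * w k * (x k - (n k)%:R)).
  apply: ler_sum => k _; have /natrP[m ->] := xnat k.
  have /andP[ln nl] := nb k.
  apply: (avg_gain_supergradient (Qv k)) => s.
    move=> /andP[s0 sn]; apply: (slope_at_le_level w0 B0 Bd Qv Prk taken).
    by rewrite s0 (leq_trans sn nl).
  by move=> ns; apply: (slope_at_gt_level w0 B0 Bd Qv Prk l0 left (leq_ltn_trans ln ns)).
rewrite big_split /=.
have -> : \sum_(k < K) avg_gain (B k) (Q k) (n k)%:R =
    objective B Q (greedy_output W w Q P rho k0).
  by apply: eq_bigr => k _; rewrite gE.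
have -> : \sum_(k < K) l * w k * (x k - (n k)%:R) =
    l * (\sum_(k < K) w k * x k - \sum_(k < K) w k * (n k)%:R).
  by rewrite -sumrB mulr_sumr; apply: eq_bigr => k _; rewrite -mulrBr mulrA.
have n0 : (0 < num_slopes P k0 rho)%N by rewrite (num_slopes_stopping rs rt) eqxx addn1.
(* With ties the stopping slope need not be the one of index [num_slopes P k0 rho]; the inequality
   [l * w k0 <= slope] for that index is all that is required. *)
have := slope_of_taken w0 B0 Bd Qv Prk taken n0.
have : l * (\sum_(k < K) w k * x k - \sum_(k < K) w k * (n k)%:R) <= l * w k0.
  by apply: ler_wpM2l => //; lra.
lra.
Qed.
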